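(* Any set of holomorphic solutions $(W_i,\bar W_i)$, $i=1,2$, of the $\mathbb{C}P^2$ sigma model equations $$\partial\bar\partial W_1-\frac{2\bar W_1}{A}\,\partial W_1\,\bar\partial W_1-\frac{\bar W_2}{A}\big(\partial W_1\,\bar\partial W_2+\bar\partial W_1\,\partial W_2\big)=0,$$ $$\partial\bar\partial W_2-\frac{2\bar W_2}{A}\,\partial W_2\,\bar\partial W_2-\frac{\bar W_1}{A}\big(\partial W_1\,\bar\partial W_2+\bar\partial W_1\,\partial W_2\big)=0,\qquad A=1+|W_1|^2+|W_2|^2,$$ defined over $S^2$ and such that the induced metric is nonzero in some neighbourhood of a regular point $p=(\xi_0,\bar\xi_0)\in\mathbb{C}$, determines a conformal parametrization of a surface $\mathbb{F}$ immersed in the $\mathfrak{su}(3)$ Lie algebra. Its moving frame on $\mathbb{F}$ can be written in terms of $3\times3$ skew-Hermitian matrices and is of the form $$\eta=(\partial X,\bar\partial X,\eta_1,\dots,\eta_6)^T,$$ where the complex tangent vectors to $\mathbb{F}$ are given by the traceless matrices $$\partial X=-\frac{i}{A^2}\begin{pmatrix}-(\bar W_1\partial W_1+\bar W_2\partial W_2)&-\bar W_1(\bar W_1\partial W_1+\bar W_2\partial W_2)&-\bar W_2(\bar W_1\partial W_1+\bar W_2\partial W_2)\\ d_1&\bar W_1d_1&\bar W_2d_1\\ d_2&\bar W_1d_2&\bar W_2d_2\end{pmatrix},$$ $$\bar\partial X=\frac{i}{A^2}\begin{pmatrix}W_1\bar\partial\bar W_1+W_2\bar\partial\bar W_2&-\bar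 d_1&-\bar d_2\\ W_1(W_1\bar\partial\bar W_1+W_2\bar\partial\bar W_2)&-W_1\bar d_1&-W_1\bar d_2\\ W_2(W_1\bar\partial\bar W_1+W_2\bar\partial\bar W_2)&-W_2\bar d_1&-W_2\bar d_2\end{pmatrix},$$ with $$d_1=(1+|W_2|^2)\,\partial W_1-W_1\bar W_2\,\partial W_2,\qquad d_2=(1+|W_1|^2)\,\partial W_2-\bar W_1W_2\,\partial W_1 .$$
   Context: Write $\xi=\xi^1+i\xi^2$, $\partial=\frac12(\partial_1-i\partial_2)$, $\bar\partial=\frac12(\partial_1+i\partial_2)$ with $\partial_\mu=\partial/\partial\xi^\mu$. The functions $W_1=f_1/f_0$, $W_2=f_2/f_0$ are affine coordinates of a map $[f_0,f_1,f_2]$ into $\mathbb{C}P^2$; one may take $f=(1,W_1,W_2)^T$. Holomorphic means $\bar\partial W_i=0$. ''Defined over $S^2$'' means that the map into $\mathbb{C}P^2$ extends to the whole Riemann sphere $S^2=\mathbb{C}\cup\{\infty\}$. Let $P=\mathbf{1}_3-\frac{1}{f^\dagger f}f\otimes f^\dagger$, $\mathbb{K}=[\bar\partial P,P]$, so $\mathbb{K}^\dagger=-[\partial P,P]$. The surface is (locally) the image of the $\mathfrak{su}(3)$-valued map $X$ with $dX=i(\mathbb{K}^\dagger d\xi+\mathbb{K}\,d\bar\xi)$, i.e. $\partial X=i\mathbb{K}^\dagger$, $\bar\partial X=i\mathbb{K}$; this form is closed as a consequence of the $\mathbb{C}P^2$ equations. The space $\mathfrak{su}(3)\simeq\mathbb{R}^8$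 of traceless skew-Hermitian matrices carries the Euclidean inner product proportional to $-\mathrm{tr}(YZ)$ (extended complex-bilinearly to complex matrices), and the induced metric has components $g_{\xi,\xi}=(\partial X,\partial X)$, $g_{\bar\xi,\bar\xi}=(\bar\partial X,\bar\partial X)$, $g_{\xi,\bar\xi}=(\partial X,\bar\partial X)$. The parametrization is conformal if $g_{\xi,\xi}=g_{\bar\xi,\bar\xi}=0$. In the moving frame, $\eta_1,\dots,\eta_6$ are real ($\mathfrak{su}(3)$-valued) unit normal vectors to the surface, mutually orthogonal and orthogonal to $\partial X$ and $\bar\partial X$. *)

(* Defs.v *)
From HB Require Import structures.
From mathcomp Require Import all_boot all_order all_algebra.
From mathcomp Require Import spectral complex generic_quotient.
From mathcomp Require Import all_classical all_reals all_analysis.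

Set Implicit Arguments.
Unset Strict Implicit.
Unset Printing Implicit Defensive.

Import Order.TTheory GRing.Theory Num.Theory.
Import numFieldNormedType.Exports.

Local Open Scope classical_set_scope.
Local Open Scope ring_scope.
Local Open Scope sesquilinear_scope.

(* The complex line is R * R, (x1, x2) standing for xi = x1 + i x2, so that
   partial derivatives are the library's directional derivatives. *)

Section Calculus.
Variable R : realType.
Implicit Types (f : R * R -> R[i]) (M : R * R -> 'M[R[i]]_3).
Implicit Types (D : set (R * R)) (v z : R * R).

Definition ci : R[i] := Complex 0 1.

Definition e1 : R * R := (1, 0).
Definition e2 : R * R := (0, 1).

(* R[i] carries no normed R-module structure in the library, so the derivative
   along a real direction is taken on real and imaginary parts. *)
Definition cderivable f z v : Prop :=
  derivable (@complex.Re R \o f) z v /\ derivable (@complex.Im R \o f) z v.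

Definition cderive v f z : R[i] :=
  Complex ('D_v (@complex.Re R \o f) z) ('D_v (@complex.Im R \o f) z).

Definition del f z : R[i] := 2%:R^-1 * (cderive e1 f z - ci * cderive e2 f z).
Definition dbar f z : R[i] := 2%:R^-1 * (cderive e1 f z + ci * cderive e2 f z).

(* C^k by continuous partial derivatives; the meaning is the usual one when D
   is open. *)
Fixpoint Ck (k : nat) D f : Prop :=
  (forall z, D z ->
     {for z, continuous (@complex.Re R \o f)} /\ {for z, continuous (@complex.Im R \o f)}) /\
  match k with
  | 0%N => True
  | k'.+1 =>
      (forall z, D z -> cderivable f z e1 /\ cderivable f z e2) /\
      Ck k' D (cderive e1 f) /\ Ck k' D (cderive e2 f)
  end.

Definition smooth D f : Prop := forall k, Ck k D f.

Definition holomorphic D f : Prop :=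
  smooth D f /\ forall z, D z -> dbar f z = 0.

Definition mxapply (op : (R * R -> R[i]) -> R * R -> R[i]) M z : 'M[R[i]]_3 :=
  \matrix_(i, j) op (fun w => M w i j) z.
Definition mxderive v := mxapply (cderive v).
Definition mxdel := mxapply del.
Definition mxdbar := mxapply dbar.

Definition mxCk k D M : Prop := forall i j, Ck k D (fun w => M w i j).
Definition mxsmooth D M : Prop := forall i j, smooth D (fun w => M w i j).

End Calculus.

Section ProjectivePlane.
Variable R : realType.

(* R[i]^o is R[i] with the topology of its absolute value. *)
Definition hvec : Type := [set v : 'rV[R[i]^o]_3 | v != 0].

Definition proportional : rel hvec :=
  fun u v => `[< exists c : R[i], set_val u = c *: (set_val v : 'rV[R[i]]_3) >].

Lemma hvec_neq0 (u : hvec) : (set_val u : 'rV[R[i]]_3) != 0.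
Proof. by have := set_valP u. Qed.

Lemma proportional_equiv : equiv_class_of proportional.
Proof.
have sym u v : proportional u v -> proportional v u.
  move=> /asboolP[k uv]; apply/asboolP; exists k^-1.
  rewrite uv scalerA mulVf ?scale1r//.
  by apply: contraNneq (hvec_neq0 u) => k0; rewrite uv k0 scale0r.
split=> [u|u v|v u w].
- by apply/asboolP; exists 1; rewrite scale1r.
- by apply/idP/idP; apply: sym.
- move=> uv vw; move/asboolP: uv => [k uv]; move/asboolP: vw => [l vw].
  by apply/asboolP; exists (k * l); rewrite uv vw scalerA.
Qed.

Canonical proportional_equivRel := EquivRelPack proportional_equiv.

Definition CP2 : Type := quotient_topology {eq_quot proportional_equivRel}%qT.

Definition affine_row (w1 w2 : R[i]) : 'rV[R[i]^o]_3 :=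
  \row_j nth 0 [:: 1; w1; w2] j.

Lemma affine_row_neq0 w1 w2 : affine_row w1 w2 \in [set v | v != 0].
Proof.
rewrite inE /=; apply/eqP => /rowP/(_ ord0).
by rewrite !mxE /=; apply/eqP; rewrite oner_eq0.
Qed.

(* The point [1, w1, w2]. *)
Definition affine_point (w1 w2 : R[i]) : CP2 :=
  \pi_CP2%qT (exist _ (affine_row w1 w2) (affine_row_neq0 w1 w2) : hvec).

Definition sphere : Type := one_point_compactification (R * R)%type.

(* [1, W1, W2] extends to a continuous map S^2 -> CP^2, and D is exactly the set
   of finite points at which W1 and W2 have finite values, i.e. the preimage of
   the affine chart; the values of W1, W2 outside D are meaningless.  D is
   automatically open.  When W1, W2 are holomorphic on D and D is nonempty, the
   extension is automatically holomorphic (Rado), so continuity is the weakest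
   reading of "extends". *)
Definition defined_over_sphere (D : set (R * R)) (W1 W2 : R * R -> R[i]) : Prop :=
  exists Phi : sphere -> CP2,
    [/\ continuous Phi,
        forall z, D z -> Phi (Some z) = affine_point (W1 z) (W2 z) &
        forall z, ~ D z -> forall w1 w2, Phi (Some z) <> affine_point w1 w2].

End ProjectivePlane.

Section Surface.
Variable R : realType.
Variables W1 W2 : R * R -> R[i].
Implicit Types (V : set (R * R)) (z : R * R) (Y Z : 'M[R[i]]_3).
Implicit Types (X : R * R -> 'M[R[i]]_3).

Let W1b z := (W1 z)^*.
Let W2b z := (W2 z)^*.

Definition A z : R[i] := 1 + `|W1 z| ^+ 2 + `|W2 z| ^+ 2.

Definition sigma_model_equations z : Prop :=
  del (dbar W1) z
    - 2%:R * W1b z / A z * (del W1 z * dbar W1 z)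
    - W2b z / A z * (del W1 z * dbar W2 z + dbar W1 z * del W2 z) = 0
  /\
  del (dbar W2) z
    - 2%:R * W2b z / A z * (del W2 z * dbar W2 z)
    - W1b z / A z * (del W1 z * dbar W2 z + dbar W1 z * del W2 z) = 0.

Definition fvec z : 'cV[R[i]]_3 := \col_j nth 0 [:: 1; W1 z; W2 z] j.

Definition Pproj z : 'M[R[i]]_3 :=
  1%:M - ((fvec z ^t* *m fvec z) ord0 ord0)^-1 *: (fvec z *m fvec z ^t*).

Definition Kmx z : 'M[R[i]]_3 :=
  mxdbar Pproj z *m Pproj z - Pproj z *m mxdbar Pproj z.

(* The prescribed values of del X and dbar X. *)
Definition tangent z : 'M[R[i]]_3 := ci R *: (Kmx z ^t*).
Definition tangentb z : 'M[R[i]]_3 := ci R *: Kmx z.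

Definition su3 Y : Prop := Y ^t* = - Y /\ \tr Y = 0.

Definition primitive V X : Prop :=
  [/\ mxCk 1 V X,
      forall z, V z -> su3 (X z) &
      forall z, V z -> mxdel X z = tangent z /\ mxdbar X z = tangentb z].

(* Complex-bilinear extension of the Euclidean inner product of su(3), whose
   positive normalization factor c is left free. *)
Definition ip (c : R) Y Z : R[i] := - (Complex c 0) * \tr (Y *m Z).

(* The metric is evaluated on the prescribed del X and dbar X, so it does not
   depend on which primitive X is chosen. *)
Definition metric_nonzero (c : R) z : Prop :=
  ~ [/\ ip c (tangent z) (tangent z) = 0,
        ip c (tangentb z) (tangentb z) = 0 &
        ip c (tangent z) (tangentb z) = 0].

Definition conformal (c : R) X z : Prop :=
  ip c (mxdel X z) (mxdel X z) = 0 /\ ip c (mxdbar X z) (mxdbar X z) = 0.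

Definition immersive X z : Prop :=
  forall a b : R,
    Complex a 0 *: mxderive (e1 R) X z + Complex b 0 *: mxderive (e2 R) X z = 0 ->
    a = 0 /\ b = 0.

Definition frame_at X (eta : 'I_6 -> R * R -> 'M[R[i]]_3) z : seq 'M[R[i]]_3 :=
  [:: mxdel X z, mxdbar X z & [seq eta j z | j <- enum 'I_6]].

Definition moving_frame (c : R) V X (eta : 'I_6 -> R * R -> 'M[R[i]]_3) : Prop :=
  (forall j, mxsmooth V (eta j)) /\
  forall z, V z ->
    [/\ forall j, su3 (eta j z),
        forall j k, ip c (eta j z) (eta k z) = (j == k)%:R,
        forall j, ip c (eta j z) (mxdel X z) = 0 /\ ip c (eta j z) (mxdbar X z) = 0 &
        free (frame_at X eta z)].

Definition mx3 (rows : seq (seq R[i])) : 'M[R[i]]_3 :=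
  \matrix_(i < 3, j < 3) nth 0 (nth [::] rows i) j.

Definition d1 z : R[i] :=
  (1 + `|W2 z| ^+ 2) * del W1 z - W1 z * W2b z * del W2 z.
Definition d2 z : R[i] :=
  (1 + `|W1 z| ^+ 2) * del W2 z - W1b z * W2 z * del W1 z.

Definition delX_formula z : 'M[R[i]]_3 :=
  let s := W1b z * del W1 z + W2b z * del W2 z in
  (- ci R / A z ^+ 2) *: mx3
    [:: [:: - s ; - (W1b z * s) ; - (W2b z * s)];
        [:: d1 z; W1b z * d1 z  ; W2b z * d1 z ];
        [:: d2 z; W1b z * d2 z  ; W2b z * d2 z ]].

Definition dbarX_formula z : 'M[R[i]]_3 :=
  let s := W1 z * dbar W1b z + W2 z * dbar W2b z in
  (ci R / A z ^+ 2) *: mx3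
    [:: [:: s       ; - (d1 z)^*         ; - (d2 z)^*         ];
        [:: W1 z * s; - (W1 z * (d1 z)^*); - (W1 z * (d2 z)^*)];
        [:: W2 z * s; - (W2 z * (d1 z)^*); - (W2 z * (d2 z)^*)]].

End Surface.

(* Main.v *)
Require Import Defs.
From mathcomp Require Import all_boot all_order all_algebra.
From mathcomp Require Import spectral complex ring.
From mathcomp Require Import all_classical all_reals all_analysis.
Import Order.TTheory GRing.Theory Num.Theory.
Import numFieldNormedType.Exports.
Local Open Scope classical_set_scope.
Local Open Scope ring_scope.
Local Open Scope sesquilinear_scope.

Set Implicit Arguments.
Unset Strict Implicit.
Unset Printing Implicit Defensive.

(** Write f' for del f, s = f^dagger f' = del A, and let Q = 1 - P be the
    orthogonal projector on the line spanned by f = (1, W1, W2)^T.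

    Since f is holomorphic, dbar only sees the factor f^dagger / A in
    Q = f f^dagger / A, so that dbar Q = f v^dagger / A^2, where v = A f' - s f
    is A times the component of f' orthogonal to f.  From P f = 0 and
    v^dagger f = 0 it follows that the commutator K = [dbar P, P] collapses to
    dbar P (Kmx_mxdbar), and as P is Hermitian, K^dagger = del P.  Hence
    X = i (P - 2/3) is a primitive on the whole domain, however complicated its
    topology (projector_map_primitive).  Any other primitive has the same first
    derivatives, which are smooth, and so is itself smooth (smooth_of_del); the
    remaining conclusions only involve these derivatives.

    Explicitly del X = - i v f^dagger / A^2, whose entries are those of the
    prescribed matrices.  As f and v are orthogonal, the matrix v f^dagger is
    nilpotent, which is conformality, while the mixed component of the metric
    is a positive multiple of |v|^2 |f|^2.  By Lagrange's identity
    |v|^2 = A |f x f'|^2, so a nonzero metric means f x f' <> 0 (wedge_gt0).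

    Where f x f' does not vanish, f, v and the complex conjugate of f x f' are
    nonzero, pairwise orthogonal and smooth; normalized, they are the columns
    of a unitary matrix U (frame_unitary).  In this frame the tangent vectors
    are del X = tau U E10 U^dagger and dbar X = - conj(tau) U E01 U^dagger with
    tau nonzero (tangent_frame).  Conjugation by U preserves the trace form,
    so normal vectors are obtained by conjugating six constant matrices of
    su(3) that are orthogonal to each other and to E10 and E01.  The Gram
    matrix then gives linear independence (free_frame), and the immersion
    property reduces to g(del X, dbar X) <> 0 (tangents_independent). *)

(** * Functions of class C^k on an open set of the plane *)

Section RealCk.
Variable R : realType.
Implicit Types (g h : R * R -> R) (D : set (R * R)) (v z : R * R).

(** The condition that [Ck] puts separately on real and imaginary parts, see
    [CkE]; closure properties are easier to prove one real function at a
    time. *)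
Fixpoint rCk (k : nat) D g : Prop :=
  (forall z, D z -> {for z, continuous g}) /\
  match k with
  | 0%N => True
  | k'.+1 =>
      (forall z, D z -> derivable g z (e1 R) /\ derivable g z (e2 R)) /\
      rCk k' D ('D_(e1 R) g) /\ rCk k' D ('D_(e2 R) g)
  end.

Lemma CkE k D (f : R * R -> R[i]) :
  Ck k D f <-> rCk k D (@complex.Re R \o f) /\ rCk k D (@complex.Im R \o f).
Proof.
elim: k f => [|k IH] f; split.
- by move=> [c _]; exact (conj (conj (fun z Dz => (c z Dz).1) I)
                               (conj (fun z Dz => (c z Dz).2) I)).
- by move=> [[c _] [d _]]; exact (conj (fun z Dz => conj (c z Dz) (d z Dz)) I).
- move=> [c [d [/IH[a1 a2] /IH[b1 b2]]]].
  exact (conj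
    (conj (fun z Dz => (c z Dz).1)
      (conj (fun z Dz => conj (d z Dz).1.1 (d z Dz).2.1) (conj a1 b1)))
    (conj (fun z Dz => (c z Dz).2)
      (conj (fun z Dz => conj (d z Dz).1.2 (d z Dz).2.2) (conj a2 b2)))).
move=> [[c [d [a b]]] [c' [d' [a' b']]]].
have Da : Ck k D (cderive (e1 R) f) by apply/IH; exact (conj a a').
have Db : Ck k D (cderive (e2 R) f) by apply/IH; exact (conj b b').
exact (conj (fun z Dz => conj (c z Dz) (c' z Dz))
  (conj (fun z Dz => conj (conj (d z Dz).1 (d' z Dz).1)
                          (conj (d z Dz).2 (d' z Dz).2))
        (conj Da Db))).
Qed.

Lemma rCkW k D g : rCk k.+1 D g -> rCk k D g.
Proof.
elim: k g => [|k IH] g; first by case.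
by move=> [c [d [/IH a /IH b]]].
Qed.

Lemma rCk_ext k D g h : open D -> (forall z, D z -> g z = h z) ->
  rCk k D g -> rCk k D h.
Proof.
move=> oD; elim: k g h => [|k IH] g h gh.
all: have nr z : D z -> \forall w \near z, g w = h w
  by move=> Dz; apply: filterS (open_nbhs_nbhs (conj oD Dz)).
all: have C : (forall z, D z -> {for z, continuous g}) ->
    forall z, D z -> {for z, continuous h}
  by move=> c z Dz; rewrite /prop_for /continuous_at -(gh z Dz);
     apply: cvg_trans (c z Dz); apply: near_eq_cvg; exact: nr.
  by case=> /C c _; exact (conj c I).
move=> [/C c [d [a b]]]; split; first exact c.
split.
  by move=> z Dz; have [x y] := d z Dz;
     split; apply: near_eq_derivable (nr _ Dz) _.
by split; [apply: (IH _ _ _ a)|apply: (IH _ _ _ b)] => z Dz;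
  apply: near_eq_derive; apply: nr.
Qed.

Lemma rCk_cst k D (a : R) : rCk k D (fun=> a).
Proof.
elim: k a => [|k IH] a; first by split=> // z _; apply: cst_continuous.
split=> [z _|]; first exact: cst_continuous.
split=> [z _|]; first by split; apply: derivable_cst.
have D0 v : 'D_v (fun=> a) = fun=> 0 by apply/funext => z; apply: derive_cst.
by rewrite !D0.
Qed.

Section Open.
Variables (D : set (R * R)) (oD : open D).

Lemma rCkD k g h : rCk k D g -> rCk k D h -> rCk k D (fun z => g z + h z).
Proof.
elim: k g h => [|k IH] g h.
  move=> [c _] [d _]; split=> // z Dz.
  by apply: continuousD; [apply: c|apply: d].
move=> [c [d [a b]]] [c' [d' [a' b']]]; split.
  by move=> z Dz; apply: continuousD; [apply: c|apply: c'].
split.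
  move=> z Dz; have [x y] := d z Dz; have [x' y'] := d' z Dz.
  exact (conj (derivableD x x') (derivableD y y')).
by split; [apply: (rCk_ext oD _ (IH _ _ a a'))|
           apply: (rCk_ext oD _ (IH _ _ b b'))];
  move=> z Dz; have [x y] := d z Dz; have [x' y'] := d' z Dz;
  [exact (esym (deriveD x x'))|exact (esym (deriveD y y'))].
Qed.

(** The Leibniz rule involves the factors themselves besides their
    derivatives; [rCkW] lowers their degree to that of the derivatives. *)
Lemma rCkM k g h : rCk k D g -> rCk k D h -> rCk k D (fun z => g z * h z).
Proof.
elim: k g h => [|k IH] g h.
  move=> [c _] [d _]; split=> // z Dz.
  by apply: continuousM; [apply: c|apply: d].
move=> cg ch; have [wg wh] := (rCkW cg, rCkW ch).
move: cg ch => [c [d [a b]]] [c' [d' [a' b']]]; split.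
  by move=> z Dz; apply: continuousM; [apply: c|apply: c'].
split.
  move=> z Dz; have [x y] := d z Dz; have [x' y'] := d' z Dz.
  exact (conj (derivableM x x') (derivableM y y')).
by split; [apply: (rCk_ext oD _ (rCkD (IH _ _ wg a') (IH _ _ wh a)))|
           apply: (rCk_ext oD _ (rCkD (IH _ _ wg b') (IH _ _ wh b)))];
  move=> z Dz; have [x y] := d z Dz; have [x' y'] := d' z Dz;
  [exact (esym (deriveM x x'))|exact (esym (deriveM y y'))].
Qed.

Lemma rCkN k g : rCk k D g -> rCk k D (fun z => - g z).
Proof.
move=> cg; apply: (rCk_ext oD _ (rCkM (rCk_cst k D (-1)) cg)) => z _ /=.
by rewrite mulN1r.
Qed.

(** Restricting g to the line through z directed by v reduces this to the chain
    rule in one variable. *)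
Lemma is_derive_rsqrt g z v : 0 < g z -> derivable g z v ->
  is_derive z v (fun w => (Num.sqrt (g w))^-1)
    (- 2^-1 * (Num.sqrt (g z))^-1 ^+ 3 * 'D_v g z).
Proof.
move=> g0 /derivable1P dg.
pose l (t : R) := g (t *: v + z).
have l0 : l 0 = g z by rewrite /l scale0r add0r.
have line (q : R * R -> R) : 'D_v q z = 'D_1 (fun t : R => q (t *: v + z)) 0.
  rewrite /derive; set q1 := fun t => t^-1 *: _; set q2 := fun t => t^-1 *: _.
  suff -> : q1 = q2 by [].
  by rewrite funeqE /q1 /q2 => t /=; rewrite addr0 scale0r add0r [_%:A]mulr1.
have dl : is_derive (0 : R) 1 l ('D_v g z) by rewrite line; apply: derivableP.
have ds : is_derive (l 0) 1 Num.sqrt (2 * Num.sqrt (l 0))^-1.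
  by apply: is_derive1_sqrt; rewrite l0.
have dc := is_derive1_comp ds dl.
have s0 : Num.sqrt (l 0) != 0 by rewrite gt_eqF// sqrtr_gt0 l0.
have dq := @ex_derive _ _ _ _ _ _ _ dc.
have dV := @derivableV R R^o (Num.sqrt \o l) 0 1 s0 dq.
have vV := @deriveV R R^o (Num.sqrt \o l) 0 1 s0 dq.
rewrite (@derive_val _ _ _ _ _ _ _ dc) in vV.
split; first by apply/derivable1P; exact dV.
refine (eq_trans (line _) (eq_trans vV _)); rewrite /= l0 /GRing.scale /=.
rewrite l0 in s0; set s := Num.sqrt _ in s0 *; field.
exact: s0.
Qed.

(** The derivative - h^3 dg / 2 of h = 1 / sqrt g is polynomial in h and dg, so
    the regularity of h rises together with that of g. *)
Lemma rCk_rsqrt k g : (forall z, D z -> 0 < g z) -> rCk k D g ->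
  rCk k D (fun z => (Num.sqrt (g z))^-1).
Proof.
move=> g0.
have C : (forall z, D z -> {for z, continuous g}) ->
    forall z, D z -> {for z, continuous (fun z => (Num.sqrt (g z))^-1)}.
  move=> c z Dz; apply: continuousV; first by rewrite gt_eqF// sqrtr_gt0 g0.
  by apply: continuous_comp; [apply: c|apply: sqrt_continuous].
elim: k => [|k IH]; first by move=> [c _]; split=> //; apply: C.
move=> cg; have h := IH (rCkW cg); move: cg => [c [d [a b]]].
have h3 := rCkM (rCk_cst k D (- 2^-1)) (rCkM h (rCkM h h)).
split; first exact: C.
split.
  by move=> z Dz; have [x y] := d z Dz;
     split; apply: ex_derive; apply: (is_derive_rsqrt (g0 z Dz)).
by split; [apply: (rCk_ext oD _ (rCkM h3 a))|apply: (rCk_ext oD _ (rCkM h3 b))];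
  move=> z Dz; have [x y] := d z Dz; apply/esym;
  rewrite (@derive_val _ _ _ _ _ _ _ (is_derive_rsqrt (g0 z Dz) _))//=
    !exprS expr0 mulr1.
Qed.

End Open.
End RealCk.

(** * The operators del and dbar *)

Section ComplexCk.
Variable R : realType.
Implicit Types (f g : R * R -> R[i]) (D : set (R * R)) (v z : R * R).

Lemma cderiveD f g z v : cderivable f z v -> cderivable g z v ->
  cderivable (fun w => f w + g w) z v /\
  cderive v (fun w => f w + g w) z = cderive v f z + cderive v g z.
Proof.
move=> [fr fi] [gr gi].
have Er : @complex.Re R \o (fun w => f w + g w)
        = (@complex.Re R \o f) + (@complex.Re R \o g).
  by apply/funext => w /=; rewrite /GRing.add /=; case: (f w); case: (g w).
have Ei : @complex.Im R \o (fun w => f w + g w)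
        = (@complex.Im R \o f) + (@complex.Im R \o g).
  by apply/funext => w /=; rewrite /GRing.add /=; case: (f w); case: (g w).
rewrite /cderivable /cderive Er Ei; split.
  exact (conj (derivableD fr gr) (derivableD fi gi)).
by rewrite (deriveD fr gr) (deriveD fi gi).
Qed.

Lemma cderiveM f g z v : cderivable f z v -> cderivable g z v ->
  cderivable (fun w => f w * g w) z v /\
  cderive v (fun w => f w * g w) z = cderive v f z * g z + f z * cderive v g z.
Proof.
move=> [fr fi] [gr gi].
have Er : @complex.Re R \o (fun w => f w * g w)
        = (@complex.Re R \o f) * (@complex.Re R \o g)
        - (@complex.Im R \o f) * (@complex.Im R \o g).
  by apply/funext => w /=; rewrite !fctE /=; case: (f w); case: (g w).
have Ei : @complex.Im R \o (fun w => f w * g w)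
        = (@complex.Re R \o f) * (@complex.Im R \o g)
        + (@complex.Im R \o f) * (@complex.Re R \o g).
  by apply/funext => w /=; rewrite !fctE /=; case: (f w); case: (g w).
rewrite /cderivable /cderive Er Ei; split.
  exact (conj (derivableB (derivableM fr gr) (derivableM fi gi))
              (derivableD (derivableM fr gi) (derivableM fi gr))).
have vr := deriveB (derivableM fr gr) (derivableM fi gi).
have vi := deriveD (derivableM fr gi) (derivableM fi gr).
rewrite (deriveM fr gr) (deriveM fi gi) in vr.
rewrite (deriveM fr gi) (deriveM fi gr) in vi.
rewrite vr vi.
rewrite /GRing.scale /=; case: (f z) (g z) => [a b] [a' b'] /=.
move: ('D_v _ z) ('D_v _ z) ('D_v _ z) ('D_v _ z) => *.
by congr Complex => /=; ring.
Qed.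

Lemma cderiveJ f z v : cderivable f z v ->
  cderivable (fun w => (f w)^*) z v /\
  cderive v (fun w => (f w)^*) z = (cderive v f z)^*.
Proof.
move=> [fr fi].
have Er : @complex.Re R \o (fun w => (f w)^*) = @complex.Re R \o f.
  by apply/funext => w /=; case: (f w).
have Ei : @complex.Im R \o (fun w => (f w)^*) = - (@complex.Im R \o f).
  by apply/funext => w /=; rewrite !fctE /=; case: (f w).
rewrite /cderivable /cderive Er Ei; split.
  exact (conj fr (derivableN fi)).
by rewrite (deriveN fi).
Qed.

Lemma cderive_cst (a : R[i]) z v :
  cderivable (fun=> a) z v /\ cderive v (fun=> a) z = 0.
Proof.
split; first exact (conj (derivable_cst _ _ _) (derivable_cst _ _ _)).
by rewrite /cderive !derive_cst.
Qed.

Definition pderivable f z := cderivable f z (e1 R) /\ cderivable f z (e2 R).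

Lemma pderivable_cst (a : R[i]) z : pderivable (fun=> a) z.
Proof. by split; apply: (proj1 (cderive_cst _ _ _)). Qed.

Lemma pderivableD f g z : pderivable f z -> pderivable g z ->
  pderivable (fun w => f w + g w) z.
Proof. by move=> [a b] [a' b']; split; apply: (proj1 (cderiveD _ _)). Qed.

Lemma pderivableM f g z : pderivable f z -> pderivable g z ->
  pderivable (fun w => f w * g w) z.
Proof. by move=> [a b] [a' b']; split; apply: (proj1 (cderiveM _ _)). Qed.

Lemma pderivableJ f z : pderivable f z -> pderivable (fun w => (f w)^*) z.
Proof. by move=> [a b]; split; apply: (proj1 (cderiveJ _)). Qed.

Lemma conj_ci : (ci R)^* = - ci R.
Proof. by rewrite /ci; apply/eqP; rewrite eq_complex /= oppr0 !eqxx. Qed.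

Lemma ciM : ci R * ci R = -1.
Proof. by have := sqr_i R; rewrite expr2. Qed.

Lemma del_cst (a : R[i]) z : del (fun=> a) z = 0.
Proof. by rewrite /del !(proj2 (cderive_cst _ _ _)); ring. Qed.

Lemma dbar_cst (a : R[i]) z : dbar (fun=> a) z = 0.
Proof. by rewrite /dbar !(proj2 (cderive_cst _ _ _)); ring. Qed.

Lemma dbarD f g z : pderivable f z -> pderivable g z ->
  dbar (fun w => f w + g w) z = dbar f z + dbar g z.
Proof.
move=> [a b] [a' b']; rewrite /dbar !(proj2 (cderiveD _ _))//.
by move: (cderive _ f z) (cderive _ f z) (cderive _ g z) (cderive _ g z) => *;
  ring.
Qed.

Lemma delD f g z : pderivable f z -> pderivable g z ->
  del (fun w => f w + g w) z = del f z + del g z.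
Proof.
move=> [a b] [a' b']; rewrite /del !(proj2 (cderiveD _ _))//.
by move: (cderive _ f z) (cderive _ f z) (cderive _ g z) (cderive _ g z) => *;
  ring.
Qed.

Lemma dbarM f g z : pderivable f z -> pderivable g z ->
  dbar (fun w => f w * g w) z = dbar f z * g z + f z * dbar g z.
Proof.
move=> [a b] [a' b']; rewrite /dbar !(proj2 (cderiveM _ _))//.
by move: (cderive _ f z) (cderive _ f z) (cderive _ g z) (cderive _ g z)
  (f z) (g z) => *; ring.
Qed.

Lemma delM f g z : pderivable f z -> pderivable g z ->
  del (fun w => f w * g w) z = del f z * g z + f z * del g z.
Proof.
move=> [a b] [a' b']; rewrite /del !(proj2 (cderiveM _ _))//.
by move: (cderive _ f z) (cderive _ f z) (cderive _ g z) (cderive _ g z)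
  (f z) (g z) => *; ring.
Qed.

Lemma dbarJ f z : pderivable f z -> dbar (fun w => (f w)^*) z = (del f z)^*.
Proof.
move=> [a b]; rewrite /dbar /del !(proj2 (cderiveJ _))//.
move: (cderive _ f z) (cderive _ f z) => *.
by rewrite rmorphM rmorphB fmorphV rmorph_nat rmorphM /= conj_ci; ring.
Qed.

Lemma delJ f z : pderivable f z -> del (fun w => (f w)^*) z = (dbar f z)^*.
Proof.
move=> [a b]; rewrite /dbar /del !(proj2 (cderiveJ _))//.
move: (cderive _ f z) (cderive _ f z) => *.
by rewrite rmorphM rmorphD fmorphV rmorph_nat rmorphM /= conj_ci; ring.
Qed.

Lemma cderive1E f z : cderive (e1 R) f z = del f z + dbar f z.
Proof. by rewrite /del /dbar; field. Qed.

Lemma cderive2E f z : cderive (e2 R) f z = ci R * (del f z - dbar f z).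
Proof.
have -> : cderive (e2 R) f z = - (ci R * ci R) * cderive (e2 R) f z.
  by rewrite ciM opprK mul1r.
by rewrite /del /dbar; field.
Qed.

Lemma CkS k D V f : V `<=` D -> Ck k D f -> Ck k V f.
Proof.
move=> VD; elim: k f => [|k IH] f; first by move=> [c _]; split=> // z /VD/c.
move=> [c [d [a b]]].
exact (conj (fun z Vz => c z (VD z Vz))
  (conj (fun z Vz => d z (VD z Vz)) (conj (IH _ a) (IH _ b)))).
Qed.

Section Open.
Variables (D : set (R * R)) (oD : open D).

Lemma Ck_ext k f g : (forall z, D z -> f z = g z) -> Ck k D f -> Ck k D g.
Proof.
move=> fg /CkE[a b]; apply/CkE; split.
  by apply: (rCk_ext oD _ a) => z Dz /=; rewrite fg.
by apply: (rCk_ext oD _ b) => z Dz /=; rewrite fg.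
Qed.

Lemma smooth_cst (a : R[i]) : smooth D (fun=> a).
Proof. by move=> k; apply/CkE; split; apply: rCk_cst. Qed.

Lemma smoothD f g : smooth D f -> smooth D g -> smooth D (fun z => f z + g z).
Proof.
move=> sf sg k; move: (sf k) (sg k) => /CkE[a b] /CkE[a' b']; apply/CkE; split.
  by apply: (rCk_ext oD _ (rCkD oD a a')) => z _ /=; case: (f z); case: (g z).
by apply: (rCk_ext oD _ (rCkD oD b b')) => z _ /=; case: (f z); case: (g z).
Qed.

Lemma smoothM f g : smooth D f -> smooth D g -> smooth D (fun z => f z * g z).
Proof.
move=> sf sg k; move: (sf k) (sg k) => /CkE[a b] /CkE[a' b']; apply/CkE; split.
  apply: (rCk_ext oD _ (rCkD oD (rCkM oD a a') (rCkN oD (rCkM oD b b')))).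
  by move=> z _ /=; case: (f z); case: (g z).
apply: (rCk_ext oD _ (rCkD oD (rCkM oD a b') (rCkM oD b a'))).
by move=> z _ /=; case: (f z); case: (g z).
Qed.

Lemma smoothJ f : smooth D f -> smooth D (fun z => (f z)^*).
Proof.
move=> sf k; move: (sf k) => /CkE[a b]; apply/CkE; split.
  by apply: (rCk_ext oD _ a) => z _ /=; case: (f z).
by apply: (rCk_ext oD _ (rCkN oD b)) => z _ /=; case: (f z).
Qed.

Lemma smoothN f : smooth D f -> smooth D (fun z => - f z).
Proof.
move=> sf k; have := smoothM (smooth_cst (-1)) sf k.
by apply: Ck_ext => z _; rewrite mulN1r.
Qed.

Lemma smooth_sum n (F : 'I_n -> R * R -> R[i]) :
  (forall i, smooth D (F i)) -> smooth D (fun z => \sum_i F i z).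
Proof.
elim: n F => [|n IH] F sF k.
  by apply: (Ck_ext _ (smooth_cst 0 k)) => z _; rewrite big_ord0.
apply: (Ck_ext _ (smoothD (IH _ (fun i => sF (widen_ord (leqnSn n) i)))
  (sF ord_max) k)).
by move=> z _; rewrite big_ord_recr.
Qed.

Lemma smooth_cderive f : smooth D f ->
  smooth D (cderive (e1 R) f) /\ smooth D (cderive (e2 R) f).
Proof. by move=> sf; split=> k; case: (sf k.+1) => _ [_ []]. Qed.

Lemma smooth_del f : smooth D f -> smooth D (del f).
Proof.
move=> /smooth_cderive[a b]; apply: smoothM; first exact: smooth_cst.
apply: smoothD => //; apply: smoothN; apply: smoothM => //; exact: smooth_cst.
Qed.

Lemma smooth_pderivable f z : D z -> smooth D f -> pderivable f z.
Proof. by move=> Dz sf; case: (sf 1%N) => _ [/(_ z Dz)]. Qed.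

(** Meant for positive x, that is, without imaginary part. *)
Definition rsqrt (x : R[i]) : R[i] := Complex (Num.sqrt (complex.Re x))^-1 0.

Lemma rsqrtM x : 0 < x -> rsqrt x * rsqrt x = x^-1.
Proof.
case: x => a b; rewrite ltcE /= => /andP[/eqP -> a0].
apply/(mulfI (_ : Complex a 0 != 0)).
  by rewrite eq_complex /= negb_and gt_eqF.
rewrite divff; last by rewrite eq_complex /= negb_and gt_eqF.
apply/eqP; rewrite eq_complex /= !(mul0r, mulr0, addr0, subr0) eqxx andbT.
by rewrite -invfM -expr2 sqr_sqrtr ?ltW// divff // gt_eqF.
Qed.

Lemma conj_rsqrt x : (rsqrt x)^* = rsqrt x.
Proof. by apply/eqP; rewrite eq_complex /= oppr0 !eqxx. Qed.

Lemma smooth_rsqrt f : (forall z, D z -> 0 < f z) -> smooth D f ->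
  smooth D (fun z => rsqrt (f z)).
Proof.
move=> f0 sf k; move: (sf k) => /CkE[a _]; apply/CkE; split; last first.
  exact: rCk_cst.
apply: (rCk_rsqrt oD _ a) => z /f0 /=.
by case: (f z) => u w; rewrite ltcE /= => /andP[].
Qed.

Lemma smoothV f : (forall z, D z -> 0 < f z) -> smooth D f ->
  smooth D (fun z => (f z)^-1).
Proof.
move=> f0 sf k; have s := smooth_rsqrt f0 sf.
by apply: (Ck_ext _ (smoothM s s k)) => z /f0 /rsqrtM.
Qed.

End Open.
End ComplexCk.

(** * Conjugating a constant frame of su(3) by a unitary matrix *)

Section Algebra.
Variable R : realType.
Local Notation C := R[i].
Implicit Types (Y Z U : 'M[C]_3) (c : R).

Lemma adjM m n p (Y : 'M[C]_(m, n)) (Z : 'M[C]_(n, p)) :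
  (Y *m Z)^t* = Z^t* *m Y^t*.
Proof. by rewrite trmx_mul map_mxM. Qed.

Lemma adjZ m n (a : C) (Y : 'M[C]_(m, n)) : (a *: Y)^t* = a^* *: Y^t*.
Proof. by rewrite linearZ /= map_mxZ. Qed.

(** The linear form given by the trace against T vanishes on the span of X. *)
Lemma notin_span (T : 'M[C]_3) (v : 'M[C]_3) (X : seq 'M[C]_3) :
  (forall x, x \in X -> \tr (x *m T) = 0) -> \tr (v *m T) != 0 ->
  v \notin <<X>>%VS.
Proof.
move=> XT; apply: contraNN => /(@coord_span _ _ _ (in_tuple X)) ->.
rewrite mulmx_suml raddf_sum /= big1 // => i _.
by rewrite -scalemxAl linearZ /= XT ?mulr0// mem_nth.
Qed.

Lemma free_orthogonal (I : eqType) (F : I -> 'M[C]_3) (s : seq I) : uniq s ->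
  (forall j, \tr (F j *m F j) != 0) ->
  (forall j k, j != k -> \tr (F j *m F k) = 0) -> free [seq F j | j <- s].
Proof.
move=> us nz orth; elim: s us => [|j s IH] /=; first by rewrite nil_free.
move=> /andP[js us]; rewrite free_cons IH// andbT.
apply: (@notin_span (F j)) (nz j) => _ /mapP[k ks ->].
by apply: orth; apply: contraNneq js => <-.
Qed.

Lemma ipC c Y Z : ip c Y Z = ip c Z Y.
Proof. by rewrite /ip mxtrace_mulC. Qed.

Lemma ipZ c a b Y Z : ip c (a *: Y) (b *: Z) = a * b * ip c Y Z.
Proof. by rewrite /ip -scalemxAl -scalemxAr !mxtraceZ; ring. Qed.

Lemma ip_lincomb c a b Y Z W :
  ip c (a *: Y + b *: Z) W = a * ip c Y W + b * ip c Z W.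
Proof. by rewrite /ip mulmxDl mxtraceD -!scalemxAl !mxtraceZ; ring. Qed.

Lemma ip_eq0 c Y Z : 0 < c -> (ip c Y Z == 0) = (\tr (Y *m Z) == 0).
Proof.
move=> c0; rewrite /ip mulf_eq0 oppr_eq0.
by rewrite [Complex c 0 == 0]eq_complex /= gt_eqF.
Qed.

Definition unitary_conj U Y := U *m Y *m U^t*.

Section Unitary.
Variables (U : 'M[C]_3) (Uu : U^t* *m U = 1%:M).

Lemma unitary_conjM Y Z :
  unitary_conj U Y *m unitary_conj U Z = unitary_conj U (Y *m Z).
Proof.
by rewrite /unitary_conj !mulmxA -[_ *m U^t* *m U]mulmxA Uu mulmx1.
Qed.

Lemma tr_unitary_conj Y : \tr (unitary_conj U Y) = \tr Y.
Proof. by rewrite /unitary_conj mxtrace_mulC mulmxA Uu mul1mx. Qed.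

Lemma unitary_conjJ Y : (unitary_conj U Y)^t* = unitary_conj U (Y^t*).
Proof. by rewrite /unitary_conj !adjM trmxCK mulmxA. Qed.

Lemma ip_unitary_conj c Y Z :
  ip c (unitary_conj U Y) (unitary_conj U Z) = ip c Y Z.
Proof. by rewrite /ip unitary_conjM tr_unitary_conj. Qed.

Lemma su3_unitary_conj Y : su3 Y -> su3 (unitary_conj U Y).
Proof.
move=> [YJ Y0]; split; last by rewrite tr_unitary_conj.
by rewrite unitary_conjJ YJ /unitary_conj mulmxN mulNmx.
Qed.

End Unitary.

(** Rescaled Gell-Mann matrices, times i; the two that are missing span the same
    complex plane as the matrix units [E10] and [E01]. *)
Definition normal_basis (j : 'I_6) : 'M[C]_3 :=
  let i := ci R in
  nth 0 [:: mx3 [:: [:: 0; 0; 0]; [:: 0; 0; 1]; [:: 0; -1; 0]];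
            mx3 [:: [:: 0; 0; 0]; [:: 0; 0; i]; [:: 0; i; 0]];
            mx3 [:: [:: 0; 0; 1]; [:: 0; 0; 0]; [:: -1; 0; 0]];
            mx3 [:: [:: 0; 0; i]; [:: 0; 0; 0]; [:: i; 0; 0]];
            mx3 [:: [:: i; 0; 0]; [:: 0; - i; 0]; [:: 0; 0; 0]];
            mx3 [:: [:: i; 0; 0]; [:: 0; i; 0]; [:: 0; 0; - (2%:R * i)]]] j.

Definition normal_sqnorm (j : 'I_6) : nat := nth 0 [:: 2; 2; 2; 2; 2; 6]%N j.

Lemma mxtrace_mul3 Y Z : \tr (Y *m Z) =
  let e (i : nat) : 'I_3 := inord i in
  let t i j := Y (e i) (e j) * Z (e j) (e i) in
  t 0%N 0%N + t 0%N 1%N + t 0%N 2%N + (t 1%N 0%N + t 1%N 1%N + t 1%N 2%N)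
  + (t 2%N 0%N + t 2%N 1%N + t 2%N 2%N).
Proof.
have E (F : 'I_3 -> C) : \sum_i F i = F (inord 0) + F (inord 1) + F (inord 2).
  by rewrite !big_ord_recl big_ord0 addr0 addrA; congr (F _ + F _ + F _);
    apply: val_inj; rewrite /= inordK.
by rewrite /mxtrace E !mxE !E.
Qed.

Lemma tr_normal_basis j k :
  \tr (normal_basis j *m normal_basis k) = - (normal_sqnorm j * (j == k))%:R.
Proof.
have := ciM R; set i := ci R => ii.
by move: j k => [[|[|[|[|[|[|//]]]]]] ?] [[|[|[|[|[|[|//]]]]]] ?];
  rewrite mxtrace_mul3 /normal_basis /normal_sqnorm /= !mxE !inordK //=
    -/i ?(mulr0, mul0r, mulrN, mulNr, opprK, addr0, add0r, mulr1, oppr0,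
          subrr, ii) //=;
  rewrite ?(mulrACA 2%:R i) ?ii; ring.
Qed.

Lemma su3_normal_basis j : su3 (normal_basis j).
Proof.
split.
  by apply/matrixP => a b; move: j a b =>
    [[|[|[|[|[|[|//]]]]]] ?] [[|[|[|//]]] ?] [[|[|[|//]]] ?];
    rewrite !mxE /normal_basis /= ?mxE /=
    ?(rmorphN, rmorphM, rmorph_nat, rmorph0, rmorph1) /= ?conj_ci; ring.
by move: j => [[|[|[|[|[|[|//]]]]]] ?]; rewrite
  /mxtrace !big_ord_recl big_ord0 /normal_basis /= !mxE /=; ring.
Qed.

Definition E10 : 'M[C]_3 := delta_mx (inord 1) (inord 0).
Definition E01 : 'M[C]_3 := delta_mx (inord 0) (inord 1).

Lemma tr_normal_E10 j : \tr (normal_basis j *m E10) = 0.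
Proof.
move: j => [[|[|[|[|[|[|//]]]]]] ?];
  rewrite mxtrace_mul3 /E10 /E01 /normal_basis /= !mxE -!val_eqE /= !inordK //=;
  ring.
Qed.

Lemma tr_normal_E01 j : \tr (normal_basis j *m E01) = 0.
Proof.
move: j => [[|[|[|[|[|[|//]]]]]] ?];
  rewrite mxtrace_mul3 /E10 /E01 /normal_basis /= !mxE -!val_eqE /= !inordK //=;
  ring.
Qed.

Lemma E10J : E10^t* = E01.
Proof. by rewrite /E10 trmx_delta map_delta_mx. Qed.

Lemma tr_E10E10 : \tr (E10 *m E10) = 0.
Proof. by rewrite mxtrace_mul3 /E10 !mxE -!val_eqE /= !inordK //=; ring. Qed.

Lemma tr_E01E01 : \tr (E01 *m E01) = 0.
Proof. by rewrite mxtrace_mul3 /E01 !mxE -!val_eqE /= !inordK //=; ring. Qed.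

Lemma tr_E10E01 : \tr (E10 *m E01) = 1.
Proof.
by rewrite mxtrace_mul3 /E10 /E01 !mxE -!val_eqE /= !inordK //=; ring.
Qed.

Definition normal_scale c j := rsqrt (Complex (c * (normal_sqnorm j)%:R) 0).

Definition normal_vector c U j :=
  normal_scale c j *: unitary_conj U (normal_basis j).

Section Frame.
Variables (c : R) (U : 'M[C]_3) (tau : C).
Hypotheses (c0 : 0 < c) (Uu : U^t* *m U = 1%:M) (tau0 : tau != 0).
Let T := tau *: unitary_conj U E10.
Let Tb := - T^t*.

Lemma frame_barE : Tb = (- tau^*) *: unitary_conj U E01.
Proof. by rewrite /Tb /T adjZ unitary_conjJ E10J scaleNr. Qed.

Lemma ip_tangent : [/\ ip c T T = 0, ip c Tb Tb = 0 & ip c T Tb != 0].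
Proof.
rewrite frame_barE /T; split.
- by rewrite ipZ ip_unitary_conj// /ip tr_E10E10 !mulr0.
- by rewrite ipZ ip_unitary_conj// /ip tr_E01E01 !mulr0.
rewrite ipZ ip_unitary_conj//; apply: mulf_neq0.
  by apply: mulf_neq0 => //; rewrite oppr_eq0 conjC_eq0.
by rewrite ip_eq0// tr_E10E01 oner_eq0.
Qed.

Lemma normal_sqnorm_gt0 j : (0 < normal_sqnorm j)%N.
Proof. by move: j => [[|[|[|[|[|[|//]]]]]] ?]. Qed.

Lemma normal_scaleM j :
  normal_scale c j * normal_scale c j * (Complex c 0 * (normal_sqnorm j)%:R)
  = 1.
Proof.
have E : Complex c 0 * (normal_sqnorm j)%:R =
    Complex (c * (normal_sqnorm j)%:R) 0.
  rewrite -[RHS]/(real_complex R _) -[Complex c 0]/(real_complex R c).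
  by rewrite rmorphM rmorph_nat.
have p : 0 < Complex (c * (normal_sqnorm j)%:R) 0.
  by rewrite ltcE /= eqxx mulr_gt0// ltr0n normal_sqnorm_gt0.
by rewrite E rsqrtM// mulVf// gt_eqF.
Qed.

Lemma ip_normal j k :
  ip c (normal_vector c U j) (normal_vector c U k) = (j == k)%:R.
Proof.
rewrite ipZ ip_unitary_conj// /ip tr_normal_basis.
have [<-|_] := eqVneq j k; last by rewrite muln0 oppr0 !mulr0.
rewrite muln1 mulrNN [LHS]mulrA -[LHS]mulrA; exact: normal_scaleM.
Qed.

Lemma ip_normal_tangent j :
  ip c (normal_vector c U j) T = 0 /\ ip c (normal_vector c U j) Tb = 0.
Proof.
rewrite frame_barE /T /normal_vector; split.
  by rewrite ipZ ip_unitary_conj// /ip tr_normal_E10 !mulr0.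
by rewrite ipZ ip_unitary_conj// /ip tr_normal_E01 !mulr0.
Qed.

Lemma su3_normal j : su3 (normal_vector c U j).
Proof.
have [NJ N0] := su3_unitary_conj Uu (su3_normal_basis j).
split; last by rewrite mxtraceZ N0 mulr0.
by rewrite adjZ conj_rsqrt NJ scalerN.
Qed.

(** Pairing with Tb kills Tb itself and the normal vectors, so it isolates the
    coefficient of T, and conversely; the normal vectors are orthonormal. *)
Lemma free_frame : free [:: T, Tb & [seq normal_vector c U j | j <- enum 'I_6]].
Proof.
have [TT TbTb TTb] := ip_tangent.
rewrite !free_cons; apply/and3P; split.
- apply: (@notin_span Tb); last by rewrite -(ip_eq0 _ _ c0).
  move=> x; rewrite inE => /orP[/eqP ->|/mapP[j _ ->]];
    apply/eqP; rewrite -(ip_eq0 _ _ c0); apply/eqP => //.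
  by have [] := ip_normal_tangent j.
- apply: (@notin_span T); last by rewrite -(ip_eq0 _ _ c0) ipC.
  move=> x /mapP[j _ ->]; apply/eqP; rewrite -(ip_eq0 _ _ c0); apply/eqP.
  by have [] := ip_normal_tangent j.
apply: free_orthogonal => [|j|j k jk]; first exact: enum_uniq.
  by rewrite -(ip_eq0 _ _ c0) ip_normal eqxx oner_eq0.
by apply/eqP; rewrite -(ip_eq0 _ _ c0) ip_normal (negbTE jk).
Qed.

(** With w = a + i b the hypothesis reads w T + conj(w) Tb = 0; pairing it with
    the isotropic vector Tb leaves w g(T, Tb) = 0. *)
Lemma tangents_independent (a b : R) :
  Complex a 0 *: (T + Tb) + Complex b 0 *: (ci R *: (T - Tb)) = 0 ->
  a = 0 /\ b = 0.
Proof.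
have [TT TbTb TTb] := ip_tangent.
have comb (Y Z : 'M[C]_3) :
    Complex a 0 *: (Y + Z) + Complex b 0 *: (ci R *: (Y - Z))
    = Complex a b *: Y + Complex a (- b) *: Z.
  have -> : Complex a b = Complex a 0 + Complex b 0 * ci R.
    by rewrite /ci; apply/eqP; rewrite eq_complex /=;
       apply/andP; split; apply/eqP; ring.
  have -> : Complex a (- b) = Complex a 0 - Complex b 0 * ci R.
    by rewrite /ci; apply/eqP; rewrite eq_complex /=;
       apply/andP; split; apply/eqP; ring.
  rewrite !scalerDr !scalerDl !scalerN !scalerA.
  by rewrite scaleNr addrACA.
rewrite comb => /(congr1 (fun Y => ip c Y Tb)).
rewrite ip_lincomb TbTb mulr0 addr0 {2}/ip mul0mx mxtrace0 mulr0 => /eqP.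
rewrite mulf_eq0 (negbTE TTb) orbF.
by rewrite eq_complex /= => /andP[/eqP -> /eqP ->].
Qed.

End Frame.
End Algebra.

(** * Smooth matrix-valued maps *)

Section MatrixSmooth.
Variables (R : realType) (D : set (R * R)) (oD : open D).
Implicit Types (M N : R * R -> 'M[R[i]]_3).

Lemma mxsmooth_cst (Y : 'M[R[i]]_3) : mxsmooth D (fun=> Y).
Proof. by move=> i j; apply: smooth_cst. Qed.

Lemma mxsmoothZ (a : R[i]) M : mxsmooth D M -> mxsmooth D (fun z => a *: M z).
Proof.
move=> sM i j k; apply: (Ck_ext oD _ (smoothM oD (smooth_cst D a) (sM i j) k)).
by move=> z _; rewrite mxE.
Qed.

Lemma mxsmoothM M N : mxsmooth D M -> mxsmooth D N ->
  mxsmooth D (fun z => M z *m N z).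
Proof.
move=> sM sN i j k.
apply: (Ck_ext oD _ (smooth_sum oD (fun l => smoothM oD (sM i l) (sN l j)) k)).
by move=> z _; rewrite mxE.
Qed.

Lemma mxsmoothJ M : mxsmooth D M -> mxsmooth D (fun z => (M z)^t*).
Proof.
move=> sM i j k; apply: (Ck_ext oD _ (smoothJ oD (sM j i) k)).
by move=> z _; rewrite !mxE.
Qed.

(** The values of del f and dbar f determine both partial derivatives of f. *)
Lemma smooth_of_del f a b : Ck 1 D f -> smooth D a -> smooth D b ->
  (forall z, D z -> del f z = a z) -> (forall z, D z -> dbar f z = b z) ->
  smooth D f.
Proof.
move=> Cf sa sb fa fb.
have sc : smooth D (ci R \*o (fun z => a z - b z)).
  by apply: (smoothM oD (smooth_cst D _)); apply: smoothD => //; apply: smoothN.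
have [c [d _]] := Cf; case=> [|k]; first exact (conj c I).
split; first exact c.
split; first exact d.
split.
  apply: (Ck_ext oD _ (smoothD oD sa sb k)) => z Dz.
  by rewrite cderive1E fa// fb.
by apply: (Ck_ext oD _ (sc k)) => z Dz; rewrite cderive2E fa// fb.
Qed.

Lemma mxderive1E M z : mxderive (e1 R) M z = mxdel M z + mxdbar M z.
Proof. by apply/matrixP => i j; rewrite !mxE cderive1E. Qed.

Lemma mxderive2E M z : mxderive (e2 R) M z = ci R *: (mxdel M z - mxdbar M z).
Proof. by apply/matrixP => i j; rewrite !mxE cderive2E. Qed.

End MatrixSmooth.

(** * The unitary frame of a point and a velocity *)

Section Frame3.
Variables (R : realType) (a b p q r t : R[i]).
Hypotheses (rJ : r^* = r) (tJ : t^* = t).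
Hypothesis rA : r * r * (1 + a * a^* + b * b^*) = 1.
Hypothesis tB :
  t * t * (p * p^* + q * q^* + (a * q - b * p) * (a * q - b * p)^*) = 1.

Let s := a^* * p + b^* * q.
Let v1 := (1 + b * b^*) * p - a * b^* * q.
Let v2 := (1 + a * a^*) * q - a^* * b * p.

(** The columns are f = (1, a, b), its velocity (0, p, q) made orthogonal to f,
    and the conjugate of the cross product of the two, which is orthogonal to
    both.  By Lagrange's identity the second has the product of the norms of
    the other two, so r and t normalize all three columns. *)
Lemma unitary_frame3 (U := mx3
   [:: [:: r * 1; r * t * - s; t * (a * q - b * p)^*];
       [:: r * a; r * t * v1; t * - q^*];
       [:: r * b; r * t * v2; t * p^*]]) : U^t* *m U = 1%:M.
Proof.
have tB' := tB; rewrite !(rmorphB, rmorphM) /= in tB'.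
rewrite /U /s /v1 /v2.
apply/matrixP => i j; rewrite !mxE !big_ord_recl big_ord0 !mxE.
move: i j => [[|[|[|//]]] ?] [[|[|[|//]]] ?] /=;
  rewrite ?(rmorphN, rmorphD, rmorphB, rmorphM, rmorph1) /= ?rmorphM /=
    ?conjCK ?rJ ?tJ.
- by apply: etrans rA; ring.
- by ring.
- by ring.
- by ring.
- by have /(etrans _) := congr2 *%R rA tB'; rewrite mulr1; apply; ring.
- by ring.
- by ring.
- by ring.
- by apply: etrans tB'; ring.
Qed.

End Frame3.

(** * Projector, tangent vectors and frame of a holomorphic curve *)

Section Curve.
Variables (R : realType) (W1 W2 : R * R -> R[i]) (V : set (R * R)).
Hypotheses (oV : open V) (s1 : smooth V W1) (s2 : smooth V W2).
Hypotheses (h1 : forall z, V z -> dbar W1 z = 0).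
Hypotheses (h2 : forall z, V z -> dbar W2 z = 0).
Implicit Types (z : R * R) (c : R).

Local Notation f := (fvec W1 W2).
Local Notation P := (Pproj W1 W2).
Local Notation A := (A W1 W2).
Local Notation d1 := (d1 W1 W2).
Local Notation d2 := (d2 W1 W2).

Definition delA z : R[i] := (W1 z)^* * del W1 z + (W2 z)^* * del W2 z.

Definition dfvec z : 'cV[R[i]]_3 := \col_j nth 0 [:: 0; del W1 z; del W2 z] j.

(** A times the component of f' orthogonal to f, see [dfperpE]. *)
Definition dfperp z : 'cV[R[i]]_3 := \col_j nth 0 [:: - delA z; d1 z; d2 z] j.

(** The squared norm of the cross product of f and f'. *)
Definition wedge z : R[i] := `|del W1 z| ^+ 2 + `|del W2 z| ^+ 2
  + `|W1 z * del W2 z - W2 z * del W1 z| ^+ 2.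

Lemma A_gt0 z : 0 < A z.
Proof. by rewrite /Defs.A -addrA ltr_wpDr ?ltr01// addr_ge0// exprn_ge0. Qed.

Lemma A_neq0 z : A z != 0. Proof. by rewrite gt_eqF// A_gt0. Qed.

Lemma AE z : A z = 1 + W1 z * (W1 z)^* + W2 z * (W2 z)^*.
Proof. by rewrite /Defs.A !normCK. Qed.

Lemma AJ z : (A z)^* = A z.
Proof. by apply: geC0_conj; rewrite ltW// A_gt0. Qed.

Lemma fvec_sqnorm z : (f z)^t* *m f z = (A z)%:M.
Proof.
apply/matrixP => i j; rewrite !ord1 !mxE !big_ord_recl big_ord0 !mxE /= AE.
by rewrite rmorph1; ring.
Qed.

Lemma dfperpE z : dfperp z = A z *: dfvec z - delA z *: f z.
Proof.
apply/matrixP => i j; rewrite !mxE.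
by move: i => [[|[|[|//]]] ?] /=; rewrite /Defs.d1 /Defs.d2 ?AE ?normCK /delA;
  move: (W1 z) (W2 z) (del W1 z) (del W2 z) => a b p q; ring.
Qed.

Lemma dfperp_entry z i :
  dfperp z i ord0 = A z * dfvec z i ord0 - delA z * f z i ord0.
Proof. by rewrite dfperpE 2![in LHS]mxE [X in _ + X]mxE [X in _ - X]mxE. Qed.

Lemma adj_entry m n (Y : 'M[R[i]]_(m, n)) i j : Y^t* i j = (Y j i)^*.
Proof. by rewrite !mxE. Qed.

Lemma dfperp_orth z : (dfperp z)^t* *m f z = 0.
Proof.
apply/matrixP => i j; rewrite !ord1 !mxE !big_ord_recl big_ord0 !mxE /=.
rewrite /Defs.d1 /Defs.d2 /delA !normCK.
move: (W1 z) (W2 z) (del W1 z) (del W2 z) => a b p q.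
rewrite !(rmorphN, rmorphD, rmorphB, rmorphM, rmorph1) /= !conjCK; ring.
Qed.

Lemma smooth_fvec i : smooth V (fun z => f z i ord0).
Proof.
have E g : (forall z, g z = f z i ord0) -> smooth V g ->
    smooth V (fun z => f z i ord0).
  by move=> gE sg k; apply: (Ck_ext oV _ (sg k)).
move: i E => [[|[|[|//]]] ?] E.
- by apply: (E (fun=> 1)) => [z|]; [rewrite mxE|apply: smooth_cst].
- by apply: (E W1) => // z; rewrite mxE.
- by apply: (E W2) => // z; rewrite mxE.
Qed.

Lemma dbar_fvec i z : V z -> dbar (fun w => f w i ord0) z = 0.
Proof.
move=> Vz; move: i => [[|[|[|//]]] ?].
- rewrite (_ : (fun _ => _) = fun=> 1) ?dbar_cst//.
  by apply/funext => w; rewrite mxE.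
- by rewrite (_ : (fun _ => _) = W1) ?h1//; apply/funext => w; rewrite mxE.
- by rewrite (_ : (fun _ => _) = W2) ?h2//; apply/funext => w; rewrite mxE.
Qed.

Lemma del_fvec i z : del (fun w => f w i ord0) z = dfvec z i ord0.
Proof.
rewrite mxE; move: i => [[|[|[|//]]] ?] /=.
- rewrite (_ : (fun _ => _) = fun=> 1) ?del_cst//.
  by apply/funext => w; rewrite mxE.
- by rewrite (_ : (fun _ => _) = W1)//; apply/funext => w; rewrite mxE.
- by rewrite (_ : (fun _ => _) = W2)//; apply/funext => w; rewrite mxE.
Qed.

Lemma smooth_sqnorm (g : R * R -> R[i]) : smooth V g ->
  smooth V (fun z => `|g z| ^+ 2).
Proof.
move=> sg k; apply: (Ck_ext oV _ (smoothM oV sg (smoothJ oV sg) k)).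
by move=> z _; rewrite normCK.
Qed.

Lemma smooth_A : smooth V A.
Proof.
apply: (smoothD oV); last exact: smooth_sqnorm.
by apply: (smoothD oV); [apply: smooth_cst|apply: smooth_sqnorm].
Qed.

Lemma smooth_invA : smooth V (fun z => (A z)^-1).
Proof. by apply: (smoothV oV _ smooth_A) => z _; apply: A_gt0. Qed.

Lemma smooth_d1 : smooth V d1.
Proof.
have [t1 t2] := (smooth_del oV s1, smooth_del oV s2).
apply: (smoothD oV); first apply: (smoothM oV) => //.
  by apply: (smoothD oV); [apply: smooth_cst|apply: smooth_sqnorm].
apply: (smoothN oV); do 2 apply: (smoothM oV) => //; exact: smoothJ.
Qed.

Lemma smooth_d2 : smooth V d2.
Proof.
have [t1 t2] := (smooth_del oV s1, smooth_del oV s2).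
apply: (smoothD oV); first apply: (smoothM oV) => //.
  by apply: (smoothD oV); [apply: smooth_cst|apply: smooth_sqnorm].
apply: (smoothN oV); do 2 apply: (smoothM oV) => //; exact: smoothJ.
Qed.

Lemma smooth_delA : smooth V delA.
Proof.
by apply: (smoothD oV); apply: (smoothM oV);
  [apply: smoothJ|apply: smooth_del|apply: smoothJ|apply: smooth_del].
Qed.

Lemma smooth_dfperp i : smooth V (fun z => dfperp z i ord0).
Proof.
have E g : (forall z, g z = dfperp z i ord0) -> smooth V g ->
    smooth V (fun z => dfperp z i ord0).
  by move=> gE sg k; apply: (Ck_ext oV _ (sg k)).
move: i E => [[|[|[|//]]] ?] E.
- apply: (E (fun z => - delA z)) => [z|]; first by rewrite mxE.
  exact: smoothN smooth_delA.
- by apply: (E d1) => [z|]; [rewrite mxE|exact: smooth_d1].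
- by apply: (E d2) => [z|]; [rewrite mxE|exact: smooth_d2].
Qed.

Lemma dbar_A z : V z -> dbar A z = (delA z)^*.
Proof.
move=> Vz; have [c1 c2] := (smooth_pderivable Vz s1, smooth_pderivable Vz s2).
have -> : A = fun w => 1 + W1 w * (W1 w)^* + W2 w * (W2 w)^*.
  by apply/funext => w; rewrite AE.
have m1 := pderivableM c1 (pderivableJ c1).
have m2 := pderivableM c2 (pderivableJ c2).
rewrite (dbarD (pderivableD (pderivable_cst 1 z) m1) m2).
rewrite (dbarD (pderivable_cst 1 z) m1) dbar_cst (dbarM c1 (pderivableJ c1)).
rewrite (dbarM c2 (pderivableJ c2)) !dbarJ// h1// h2//.
rewrite /delA; move: (W1 z) (W2 z) (del W1 z) (del W2 z) => a b p q.
by rewrite rmorphD !rmorphM /= !conjCK; ring.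
Qed.

(** Differentiate A * A^-1 = 1. *)
Lemma dbar_invA z : V z -> dbar (fun w => (A w)^-1) z = - (A z)^-2 * (delA z)^*.
Proof.
move=> Vz; have cA := smooth_pderivable Vz smooth_A.
have cV := smooth_pderivable Vz smooth_invA.
have := dbarM cA cV; rewrite dbar_A//.
rewrite (_ : (fun w => A w * (A w)^-1) = fun=> 1); last first.
  by apply/funext => w; rewrite divff// A_neq0.
rewrite dbar_cst => E; apply: (mulfI (A_neq0 z)); apply/eqP.
rewrite -subr_eq0; apply/eqP; rewrite [RHS]E.
by field; apply: A_neq0.
Qed.

Lemma PprojE z : P z = 1%:M - (A z)^-1 *: (f z *m (f z)^t*).
Proof. by rewrite /Pproj fvec_sqnorm mxE eqxx mulr1n. Qed.

Lemma Pproj_entry z i j :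
  P z i j = (i == j)%:R + (- 1) * ((A z)^-1 * (f z i ord0 * (f z j ord0)^*)).
Proof. by rewrite PprojE !mxE big_ord1 !mxE mulN1r. Qed.

Lemma mxsmooth_Pproj : mxsmooth V P.
Proof.
move=> i j k; set g := (X in Ck _ _ X).
have -> : g = fun z =>
    (i == j)%:R + (- 1) * ((A z)^-1 * (f z i ord0 * (f z j ord0)^*)).
  by apply/funext => z; rewrite /g Pproj_entry.
apply: (smoothD oV); first exact: smooth_cst.
apply: (smoothM oV); first exact: smooth_cst.
apply: (smoothM oV); first exact: smooth_invA.
by apply: (smoothM oV); [|apply: (smoothJ oV)]; apply: smooth_fvec.
Qed.

(** Since dbar f = 0, only the conjugate factor and 1 / A contribute. *)
Lemma mxdbar_Pproj z : V z -> mxdbar P z = - (A z)^-2 *: (f z *m (dfperp z)^t*).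
Proof.
move=> Vz; apply/matrixP => i j.
rewrite mxE [RHS]mxE [X in _ = _ * X]mxE big_ord1.
have -> : (fun w => P w i j) = fun w =>
    (i == j)%:R + (- 1) * ((A w)^-1 * (f w i ord0 * (f w j ord0)^*)).
  by apply/funext => w; rewrite Pproj_entry.
have cV := smooth_pderivable Vz smooth_invA.
have ci := smooth_pderivable Vz (smooth_fvec i).
have cj := smooth_pderivable Vz (smooth_fvec j).
have cij := pderivableM ci (pderivableJ cj).
have cVij := pderivableM cV cij.
rewrite (dbarD (pderivable_cst _ z) (pderivableM (pderivable_cst _ z) cVij)).
rewrite (dbarM (pderivable_cst _ z) cVij) (dbarM cV cij).
rewrite (dbarM ci (pderivableJ cj)).
rewrite !dbar_cst dbarJ// dbar_fvec// dbar_invA// del_fvec.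
rewrite adj_entry dfperp_entry rmorphB !rmorphM /= AJ.
have := A_neq0 z; move: (A z) (delA z)^* (f z i ord0) (f z j ord0)^*
  (dfvec z j ord0)^* => x s fi fj gj x0.
by field.
Qed.

Lemma Pproj_f z : P z *m f z = 0.
Proof.
rewrite PprojE mulmxBl mul1mx -scalemxAl -mulmxA fvec_sqnorm.
by rewrite mul_mx_scalar scalerA mulVf ?A_neq0// scale1r subrr.
Qed.

Lemma dfperp_Pproj z : (dfperp z)^t* *m P z = (dfperp z)^t*.
Proof.
rewrite PprojE mulmxBr mulmx1 -scalemxAr mulmxA dfperp_orth mul0mx.
by rewrite scaler0 subr0.
Qed.

(** Of the two terms of the commutator, P dbar P vanishes since P kills f, and
    dbar P P is dbar P since P fixes the orthogonal of f. *)
Lemma Kmx_mxdbar z : V z -> Kmx W1 W2 z = mxdbar P z.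
Proof.
move=> Vz; rewrite /Kmx mxdbar_Pproj// -scalemxAl -scalemxAr -!mulmxA.
by rewrite dfperp_Pproj mulmxA Pproj_f mul0mx scaler0 subr0.
Qed.

Lemma PprojJ z : (P z)^t* = P z.
Proof.
apply/matrixP => i j; rewrite [LHS]mxE [X in X^*]mxE !Pproj_entry.
rewrite rmorphD !rmorphM rmorphN rmorph1 rmorph_nat fmorphV /= AJ conjCK.
by rewrite eq_sym [_ * f z i _]mulrC.
Qed.

Lemma mxdel_Pproj z : V z -> mxdel P z = (mxdbar P z)^t*.
Proof.
move=> Vz; apply/matrixP => i j; rewrite !mxE -delJ; last first.
  exact: smooth_pderivable Vz (mxsmooth_Pproj j i).
congr (del _ z); apply/funext => w.
by have /matrixP/(_ i j) := PprojJ w; rewrite !mxE.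
Qed.

Lemma tangentbE z : V z ->
  tangentb W1 W2 z = (- ci R / A z ^+ 2) *: (f z *m (dfperp z)^t*).
Proof.
by move=> Vz; rewrite /tangentb Kmx_mxdbar// mxdbar_Pproj// scalerA mulrN mulNr.
Qed.

Lemma tangentE z : V z ->
  tangent W1 W2 z = (- ci R / A z ^+ 2) *: (dfperp z *m (f z)^t*).
Proof.
move=> Vz; rewrite /tangent Kmx_mxdbar// mxdbar_Pproj// adjZ adjM trmxCK.
by rewrite scalerA rmorphN fmorphV rmorphXn /= AJ mulrN mulNr.
Qed.

Lemma tangentb_adj z : tangentb W1 W2 z = - (tangent W1 W2 z)^t*.
Proof. by rewrite /tangentb /tangent adjZ trmxCK conj_ci scaleNr opprK. Qed.

Lemma mxsmooth_outer (g : R * R -> R[i]) (u w : R * R -> 'cV[R[i]]_3) :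
  smooth V g -> (forall i, smooth V (fun z => u z i ord0)) ->
  (forall i, smooth V (fun z => w z i ord0)) ->
  mxsmooth V (fun z => g z *: (u z *m (w z)^t*)).
Proof.
move=> sg su sw i j k.
apply: (Ck_ext oV _ (smoothM oV sg (smoothM oV (su i) (smoothJ oV (sw j))) k)).
by move=> z _; rewrite !mxE big_ord1 !mxE.
Qed.

Lemma smooth_coef : smooth V (fun z => - ci R / A z ^+ 2).
Proof.
move=> k; have sA := smooth_invA.
apply: (Ck_ext oV _ (smoothM oV (smooth_cst V (- ci R)) (smoothM oV sA sA) k)).
by move=> z _; rewrite -invfM -expr2.
Qed.

Lemma mxsmooth_tangent : mxsmooth V (tangent W1 W2).
Proof.
move=> i j k.
apply: (Ck_ext oV _
  (mxsmooth_outer smooth_coef smooth_dfperp smooth_fvec i j k)).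
by move=> z Vz; rewrite tangentE.
Qed.

Lemma mxsmooth_tangentb : mxsmooth V (tangentb W1 W2).
Proof.
move=> i j k.
apply: (Ck_ext oV _
  (mxsmooth_outer smooth_coef smooth_fvec smooth_dfperp i j k)).
by move=> z Vz; rewrite tangentbE.
Qed.

Lemma tangent_formula z : V z -> tangent W1 W2 z = delX_formula W1 W2 z.
Proof.
move=> Vz; rewrite tangentE// /delX_formula; congr (_ *: _).
apply/matrixP => i j; rewrite !mxE big_ord1 !mxE.
rewrite /delA.
move: (d1 z) (d2 z) (W1 z) (W2 z) (del W1 z) (del W2 z) => x y a b p q.
move: i j => [[|[|[|//]]] ?] [[|[|[|//]]] ?] /=; rewrite ?rmorph1; ring.
Qed.

Lemma tangentb_formula z : V z -> tangentb W1 W2 z = dbarX_formula W1 W2 z.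
Proof.
move=> Vz; rewrite tangentbE// /dbarX_formula mulNr scaleNr -scalerN.
congr (_ *: _).
rewrite !dbarJ;
  [|exact: smooth_pderivable Vz s2|exact: smooth_pderivable Vz s1].
apply/matrixP => i j; rewrite !mxE big_ord1 !mxE.
rewrite /delA.
move: (d1 z) (d2 z) (W1 z) (W2 z) (del W1 z) (del W2 z) => x y a b p q.
move: i j => [[|[|[|//]]] ?] [[|[|[|//]]] ?] /=;
  rewrite ?(rmorphN, rmorphD, rmorphM) /= ?rmorphD ?rmorphM /= ?conjCK; ring.
Qed.

Lemma tr_tangent z : \tr (tangent W1 W2 z) = 0 /\ \tr (tangentb W1 W2 z) = 0.
Proof.
have K0 : \tr (Kmx W1 W2 z) = 0 by rewrite /Kmx raddfB /= mxtrace_mulC subrr.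
rewrite /tangent /tangentb !mxtraceZ trace_map_mx mxtrace_tr K0.
by rewrite rmorph0 mulr0.
Qed.

(** If f x f' vanishes then so does f', as f has first coordinate 1 and f' has
    first coordinate 0; the tangent vectors and the metric vanish with it. *)
Lemma wedge_gt0 c z : V z -> metric_nonzero W1 W2 c z -> 0 < wedge z.
Proof.
move=> Vz nz; rewrite lt_def; apply/andP; split; last first.
  by rewrite /wedge !addr_ge0// exprn_ge0.
apply/eqP => /eqP; rewrite /wedge paddr_eq0 ?addr_ge0 ?exprn_ge0//.
rewrite paddr_eq0 ?exprn_ge0// !expf_eq0 /= !normr_eq0.
move=> /andP[/andP[/eqP p0 /eqP q0] _].
have v0 : dfperp z = 0.
  apply/matrixP => i j; rewrite !mxE /Defs.d1 /Defs.d2 /delA p0 q0.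
  by move: i => [[|[|[|//]]] ?] /=; ring.
apply: nz; rewrite tangentE// tangentbE// v0 mul0mx.
by rewrite trmx0 map_mx0 mulmx0 scaler0 /ip !mul0mx mxtrace0 mulr0.
Qed.

Definition curve_frame z : 'M[R[i]]_3 :=
  let r := rsqrt (A z) in let t := rsqrt (wedge z) in
  mx3 [:: [:: r * 1; r * t * - delA z;
                 t * (W1 z * del W2 z - W2 z * del W1 z)^*];
          [:: r * W1 z; r * t * d1 z; t * - (del W2 z)^*];
          [:: r * W2 z; r * t * d2 z; t * (del W1 z)^*]].

Lemma frame_unitary z : 0 < wedge z ->
  (curve_frame z)^t* *m curve_frame z = 1%:M.
Proof.
move=> B0; rewrite /curve_frame /Defs.d1 /Defs.d2 !normCK.
apply: unitary_frame3.
- exact: conj_rsqrt.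
- exact: conj_rsqrt.
- by rewrite -AE rsqrtM ?A_gt0// mulVf// A_neq0.
- by rewrite -!normCK rsqrtM// mulVf// gt_eqF.
Qed.

(** Where f x f' does not vanish this is - i |v| |f| / A^2, since
    |f|^2 = A and |v|^2 = A |f x f'|^2. *)
Definition tangent_coef z : R[i] := - ci R * rsqrt (wedge z) * wedge z / A z.

Lemma tangent_coef_neq0 z : 0 < wedge z -> tangent_coef z != 0.
Proof.
move=> B0; have Bn0 : wedge z != 0 by rewrite gt_eqF.
have t0 : rsqrt (wedge z) != 0.
  by apply: contra_neq (invr_neq0 Bn0); rewrite -rsqrtM// => ->; rewrite mul0r.
have i0 : ci R != 0 by rewrite eq_complex /= negb_and oner_eq0 orbT.
by rewrite !mulf_neq0 ?invr_eq0 ?oppr_eq0// A_neq0.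
Qed.

(** Up to normalization, v and f are the second and the first column of the
    frame. *)
Lemma tangent_frame z : V z -> 0 < wedge z ->
  tangent W1 W2 z = tangent_coef z *: unitary_conj (curve_frame z) (E10 R).
Proof.
move=> Vz B0; rewrite tangentE//.
have -> : unitary_conj (curve_frame z) (E10 R)
    = (rsqrt (A z) * rsqrt (wedge z) * rsqrt (A z)) *: (dfperp z *m (f z)^t*).
  rewrite /unitary_conj /E10 -(mul_delta_mx (0 : 'I_1)) mulmxA -colE.
  rewrite -mulmxA -rowE.
  have -> : col (inord 1) (curve_frame z)
          = (rsqrt (A z) * rsqrt (wedge z)) *: dfperp z.
    apply/matrixP => i j; rewrite !mxE inordK //=.
    by move: i => [[|[|[|//]]] ?] /=.
  have -> : row (inord 0) ((curve_frame z)^t*) = rsqrt (A z) *: (f z)^t*.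
    apply/matrixP => i j; rewrite !mxE inordK //=.
    by move: j => [[|[|[|//]]] ?] /=; rewrite rmorphM /= conj_rsqrt.
  by rewrite -scalemxAl -scalemxAr scalerA.
rewrite scalerA /tangent_coef; congr (_ *: _).
have -> : forall a b i iA : R[i],
  i * b * wedge z * iA * (a * b * a) = i * iA * (a * a) * (b * b * wedge z).
  by move=> *; ring.
rewrite !rsqrtM ?A_gt0// mulVf ?gt_eqF// mulr1 -mulrA -invfM -expr2.
by [].
Qed.

Lemma mxsmooth_frame : (forall z, V z -> 0 < wedge z) -> mxsmooth V curve_frame.
Proof.
move=> B0; have [t1 t2] := (smooth_del oV s1, smooth_del oV s2).
have sr : smooth V (fun z => rsqrt (A z)).
  by apply: (smooth_rsqrt oV _ smooth_A) => z _; apply: A_gt0.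
have sm : smooth V (fun z => W1 z * del W2 z - W2 z * del W1 z).
  by apply: (smoothD oV); [|apply: (smoothN oV)]; apply: (smoothM oV).
have st : smooth V (fun z => rsqrt (wedge z)).
  apply: (smooth_rsqrt oV B0); do 2?apply: (smoothD oV); exact: smooth_sqnorm.
have srt := smoothM oV sr st.
move=> i j.
have E g : (forall z, g z = curve_frame z i j) -> smooth V g ->
    smooth V (fun z => curve_frame z i j).
  by move=> gE sg k; apply: (Ck_ext oV _ (sg k)).
move: i j E => [[|[|[|//]]] ?] [[|[|[|//]]] ?] E;
  apply: E => [z|]; try by rewrite mxE.
- exact: smoothM sr (smooth_cst _ _).
- exact: smoothM srt (smoothN oV smooth_delA).
- exact: smoothM st (smoothJ oV sm).
- exact: smoothM sr s1.
- exact: smoothM srt smooth_d1.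
- exact: smoothM st (smoothN oV (smoothJ oV t2)).
- exact: smoothM sr s2.
- exact: smoothM srt smooth_d2.
- exact: smoothM st (smoothJ oV t1).
Qed.

Lemma tr_Pproj z : \tr (P z) = 2%:R.
Proof.
rewrite PprojE raddfB /= mxtrace1 mxtraceZ mxtrace_mulC fvec_sqnorm.
by rewrite mxtrace_scalar mulr1n mulVf ?A_neq0// -natr1 addrK.
Qed.

(** As P has trace 2, subtracting 2/3 makes it traceless. *)
Definition projector_map z : 'M[R[i]]_3 := ci R *: (P z - (2%:R / 3%:R)%:M).

Lemma projector_map_primitive : primitive W1 W2 V projector_map.
Proof.
have Xe z i j : projector_map z i j =
    ci R * (P z i j + - ((2%:R / 3%:R)%:M : 'M[R[i]]_3) i j).
  by rewrite [LHS]mxE [X in _ * X]mxE [X in _ * (_ + X)]mxE.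
have dX z i j : V z ->
    mxdel projector_map z i j = ci R * mxdel P z i j /\
    mxdbar projector_map z i j = ci R * mxdbar P z i j.
  move=> Vz; rewrite [mxdel projector_map z _ _]mxE.
  rewrite [mxdbar projector_map z _ _]mxE.
  under eq_fun do rewrite Xe.
  have cP := smooth_pderivable Vz (mxsmooth_Pproj i j).
  have cD := pderivableD cP
    (pderivable_cst (- ((2%:R / 3%:R)%:M : 'M[R[i]]_3) i j) z).
  rewrite (delM (pderivable_cst _ z) cD) (dbarM (pderivable_cst _ z) cD).
  rewrite (delD cP (pderivable_cst _ z)) (dbarD cP (pderivable_cst _ z)).
  by rewrite !del_cst !dbar_cst !mul0r !add0r !addr0 !mxE.
split.
- move=> i j; set k := 1%N.
  apply: (Ck_ext oV _ (smoothM oV (smooth_cst V (ci R))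
    (smoothD oV (mxsmooth_Pproj i j)
       (smooth_cst V (- ((2%:R / 3%:R)%:M : 'M[R[i]]_3) i j))) k)).
  by move=> z _; rewrite Xe.
- move=> z _; split; last first.
    rewrite mxtraceZ raddfB /= tr_Pproj mxtrace_scalar -[X in _ - X]mulr_natr.
    by rewrite divfK ?subrr ?mulr0// pnatr_eq0.
  rewrite adjZ conj_ci scaleNr linearB /= map_mxB PprojJ.
  by rewrite tr_scalar_mx map_scalar_mx /= fmorph_div /= !rmorph_nat.
- move=> z Vz; rewrite /tangent /tangentb Kmx_mxdbar// -mxdel_Pproj//.
  by split; apply/matrixP => i j; have [a b] := dX z i j Vz;
    rewrite [RHS]mxE ?a ?b.
Qed.

End Curve.

(** * The conformal immersion and its moving frame *)

Theorem proposition4 (R : realType) (c : R) (D V : set (R * R))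
    (W1 W2 : R * R -> R[i]) (p : R * R) :
  0 < c ->
  holomorphic D W1 -> holomorphic D W2 ->
  (forall z, D z -> sigma_model_equations W1 W2 z) ->
  defined_over_sphere D W1 W2 ->
  D p -> open V -> V p -> V `<=` D ->
  (forall z, V z -> metric_nonzero W1 W2 c z) ->
  (exists X : R * R -> 'M[R[i]]_3, primitive W1 W2 V X) /\
  forall X : R * R -> 'M[R[i]]_3, primitive W1 W2 V X ->
    [/\ mxsmooth V X,
        forall z, V z -> conformal c X z /\ immersive X z,
        forall z, V z ->
          [/\ mxdel X z = delX_formula W1 W2 z,
              mxdbar X z = dbarX_formula W1 W2 z,
              \tr (mxdel X z) = 0 & \tr (mxdbar X z) = 0] &
        exists eta : 'I_6 -> R * R -> 'M[R[i]]_3, moving_frame c V X eta].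
Proof.
move=> c0 [sD1 hD1] [sD2 hD2] _ _ _ oV _ VD nz.
have s1 : smooth V W1 by move=> k; apply: CkS VD (sD1 k).
have s2 : smooth V W2 by move=> k; apply: CkS VD (sD2 k).
have h1 z : V z -> dbar W1 z = 0 by move/VD; apply: hD1.
have h2 z : V z -> dbar W2 z = 0 by move/VD; apply: hD2.
split; first by exists (projector_map W1 W2); apply: projector_map_primitive.
move=> X [CX _ dX].
have B0 z : V z -> 0 < wedge W1 W2 z.
  by move=> Vz; apply: (wedge_gt0 oV s1 s2 h1 h2 Vz (nz z Vz)).
have Uu z : V z -> (curve_frame W1 W2 z)^t* *m curve_frame W1 W2 z = 1%:M.
  by move=> Vz; apply: frame_unitary; apply: B0.
have delX z : V z ->
    mxdel X z = tangent_coef W1 W2 z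
                *: unitary_conj (curve_frame W1 W2 z) (E10 R).
  by move=> Vz; rewrite (dX z Vz).1 (tangent_frame oV s1 s2 h1 h2 Vz)// B0.
have dbarX z : V z -> mxdbar X z = - (mxdel X z)^t*.
  by move=> Vz; rewrite (dX z Vz).1 (dX z Vz).2 tangentb_adj.
have tau0 z : V z -> tangent_coef W1 W2 z != 0.
  by move=> Vz; apply: tangent_coef_neq0; apply: B0.
split.
- move=> i j.
  have st := mxsmooth_tangent oV s1 s2 h1 h2 i j.
  have sb := mxsmooth_tangentb oV s1 s2 h1 h2 i j.
  apply: (smooth_of_del oV (CX i j) st sb) => z Vz.
    by have /matrixP/(_ i j) := (dX z Vz).1; rewrite [LHS]mxE.
  by have /matrixP/(_ i j) := (dX z Vz).2; rewrite [LHS]mxE.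
- move=> z Vz.
  have [TT TbTb _] := ip_tangent c0 (Uu z Vz) (tau0 z Vz).
  rewrite -(delX z Vz) -(dbarX z Vz) in TT TbTb.
  split=> // a b; rewrite mxderive1E mxderive2E dbarX// delX//.
  by apply: tangents_independent c0 (Uu z Vz) (tau0 z Vz) _ _.
- move=> z Vz; have [t1 t2] := tr_tangent W1 W2 z.
  rewrite (dX z Vz).1 (dX z Vz).2; split=> //.
    exact: (tangent_formula oV s1 s2 h1 h2 Vz).
  exact: (tangentb_formula oV s1 s2 h1 h2 Vz).
exists (fun j z => normal_vector c (curve_frame W1 W2 z) j); split.
  move=> j; apply: (mxsmoothZ oV); apply: (mxsmoothM oV).
    apply: (mxsmoothM oV (mxsmooth_frame oV s1 s2 B0)); exact: mxsmooth_cst.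
  exact: (mxsmoothJ oV (mxsmooth_frame oV s1 s2 B0)).
move=> z Vz; split.
- by move=> j; apply: su3_normal (Uu z Vz) _.
- by move=> j k; apply: ip_normal c0 (Uu z Vz) _ _.
- by move=> j; rewrite dbarX// delX//; apply: ip_normal_tangent (Uu z Vz) _.
- rewrite /frame_at dbarX// delX//.
  by apply: free_frame c0 (Uu z Vz) (tau0 z Vz).
Qed.
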